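(* Let $\mathbf{a}$ be a weak composition of length $n$. Consider the graph with vertex set $\mathrm{LKT}(\mathbf{a})$ and an edge between $T$ and $e_i(T)$ whenever $1\le i<n$ and $e_i(T)\neq 0$, where $e_i$ is the lock raising operator. Then this graph is connected.
   Context: A weak composition is a finite sequence $\mathbf{a}=(a_1,\ldots,a_n)$ of nonnegative integers. A diagram is a finite set of cells $(c,r)$ with $c,r$ positive integers ($c$ column, $r$ row, rows numbered from the bottom). A labeled diagram assigns a positive integer label to each cell; $\mathbb{D}(T)$ denotes its underlying (unlabeled) diagram. Let $M=\max_i a_i$. A lock Kohnert tableau of content $\mathbf{a}$ is a labeled diagram with labels $1^{a_1},\ldots,n^{a_n}$ (one per cell) such that: (1) for each $i$ there is exactly one cell labeled $i$ in each of the columns $M-a_i+1,\ldots,M$; (2) every label in row $r$ is at least $r$; (3) the cells labeled $i$ weakly descend (in row index) from left to right; (4) labels strictly decrease going down each column. $\mathrm{LKT}(\mathbf{a})$ is the set of these; each diagram has at most one labeling making it a lock Kohnert tableau of content $\mathbf{a}$. Raising operators on diagrams: for a diagram $D$ and $i\ge1$, the vertical $i$-pairing pairs any cells in rows $i$ and $i+1$ lying in the same column, and then iteratively pairs any unpaired cell of row $i+1$ with the rightmost unpaired cell of row $i$ in a column to its left, whenever all cells of rows $i,i+1$ in the columns strictly between them are already paired. $e_i(D)$ is obtained by moving the rightmost unpaired cell of row $i+1$ to row $i$ in the same column; $e_i(D)=0$ if row $i+1$ has no unpaired cell. The lock raising operator: for $T\in\mathrm{LKT}(\mathbf{a})$,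 $e_i(T)$ is the unique element of $\mathrm{LKT}(\mathbf{a})$ with underlying diagram $e_i(\mathbb{D}(T))$ if $e_i(\mathbb{D}(T))\neq0$ and such an element exists, and $e_i(T)=0$ otherwise. *)

(* Defs.v *)
From Stdlib Require Import Relations.Relation_Operators.
From mathcomp Require Import all_boot finmap boolp.

Set Implicit Arguments.
Unset Strict Implicit.
Unset Printing Implicit Defensive.

Local Open Scope nat_scope.
Local Open Scope fset_scope.
Local Open Scope fmap_scope.

(* A cell is a pair (column, row); columns and rows are numbered from 1, which
   [is_diagram] enforces. *)
Definition cell : choiceType := (nat * nat)%type.
Definition col (x : cell) : nat := x.1.
Definition row (x : cell) : nat := x.2.

Definition diagram : choiceType := {fset cell}.
Definition is_diagram (D : diagram) : Prop :=
  forall x, x \in D -> 0 < col x /\ 0 < row x.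

(* The underlying diagram of T is its domain [domf T]. *)
Definition labeled_diagram : choiceType := {fmap cell -> nat}.
Definition has_label (T : labeled_diagram) (x : cell) (l : nat) : Prop :=
  T.[? x] = Some l.

(* The part a_l of a weak composition, with parts numbered from 1; it is 0 when
   l = 0 or l > size a. *)
Definition part (a : seq nat) (l : nat) : nat := nth 0 (0 :: a) l.
Definition max_part (a : seq nat) : nat := \max_(m <- a) m.

Record LKT (a : seq nat) (T : labeled_diagram) : Prop := MkLKT {
  LKT_diagram : is_diagram (domf T);
  (* For l = 0 and l > size a this says that l is not used as a label. *)
  LKT_content : forall l,
    #|` [fset x in domf T | T.[? x] == Some l]| = part a l;
  LKT_columns : forall l c, 1 <= l <= size a ->
    max_part a - part a l + 1 <= c <= max_part a ->
    exists! r, has_label T (c, r) l;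
  LKT_flag : forall x l, has_label T x l -> row x <= l;
  LKT_descend : forall x y l, has_label T x l -> has_label T y l ->
    col x < col y -> row y <= row x;
  LKT_strict : forall x y l m, has_label T x l -> has_label T y m ->
    col x = col y -> row x < row y -> l < m
}.

(* A pairing is a set of pairs (x, y), x in row i and y in row i.+1. *)
Definition pairing : choiceType := {fset cell * cell}.
Definition paired (P : pairing) (z : cell) : bool :=
  has (fun p => (z == p.1) || (z == p.2)) P.

Definition column_pairs (D : diagram) (i : nat) : pairing :=
  [fset p in D `*` D | [&& row p.1 == i, row p.2 == i.+1 & col p.1 == col p.2]].

(* As every cell strictly between x and y is already paired, x is the rightmost
   unpaired cell of row i to the left of y. *)
Definition can_pair (D : diagram) (i : nat) (P : pairing) (x y : cell) : bool :=
  [&& row x == i, row y == i.+1, col x < col y, ~~ paired P x, ~~ paired P y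
    & all (fun z => ((row z == i) || (row z == i.+1)) &&
                    (col x < col z < col y) ==> paired P z) D].

(* Two distinct pairs that can be added to P never share a cell, so all of them
   are added at once. *)
Definition pairing_step (D : diagram) (i : nat) (P : pairing) : pairing :=
  P `|` [fset p in D `*` D | can_pair D i P p.1 p.2].

(* A step that changes the pairing pairs at least two new cells, so the
   iteration is stationary after #|` D| steps. *)
Definition vertical_pairing (D : diagram) (i : nat) : pairing :=
  iter #|` D| (pairing_step D i) (column_pairs D i).

(* The operator e_i on diagrams; [None] stands for 0. *)
Definition raise (i : nat) (D : diagram) : option diagram :=
  let U := [fset y in D | (row y == i.+1) && ~~ paired (vertical_pairing D i) y]
  in if U == fset0 then None
     else let c := \max_(y <- U) col y in
          Some ((c, i) |` (D `\ (c, i.+1))).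

(* The operator e_i on LKT(a); [None] stands for 0. The choice of U is
   immaterial, since a diagram has at most one labeling in LKT(a). *)
Definition lock_raise (a : seq nat) (i : nat) (T : labeled_diagram) :
    option labeled_diagram :=
  if raise i (domf T) is Some D then
    if pselect (exists U, LKT a U /\ domf U = D) is left exU
    then Some (sval (cid exU)) else None
  else None.

Definition connected_graph (X : Type) (V : X -> Prop) (E : X -> X -> Prop) :
    Prop :=
  (exists x, V x) /\
  forall x y, V x -> V y ->
    clos_refl_sym_trans X (fun u v => [/\ V u, V v & E u v]) x y.

(* Main.v *)
Require Import Defs.
From Stdlib Require Import Relations.Relation_Operators.
From mathcomp Require Import all_boot order ssralg ssrnum ssrint zify.
From mathcomp Require Import finmap boolp.

Set Implicit Arguments.
Unset Strict Implicit.
Unset Printing Implicit Defensive.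

Local Open Scope fset_scope.
Local Open Scope fmap_scope.
Local Open Scope nat_scope.

(* A lock Kohnert tableau is a function giving the row [f l c] of each label
   [l] in each column [c] where it occurs. The condition "label [l] lies in
   rows at most [l]" is generalized to "in rows at most [b l]" for a weakly
   increasing [b], and connectivity is proved by induction on the sum of [b].
   A label [l] preceded by [k] other labels always lies above row [k]. If this
   forces every label, there is only one tableau. Otherwise let [j] be the
   smallest label not so forced and [B = b j]; every tableau is linked to one
   whose cells labeled [j] avoid row [B], so [b j] can be decreased.

   To see this, first apply the inverses of the [e_i] for rows [i < B] above the
   forced labels, as long as possible. Such a move of the leftmost unpaired
   cell of row [i] up to row [i.+1] always yields a tableau: a label of row [i]
   to its left would need a larger label above it, and that one would block the
   move. At the end, in every column with label [j] all rows from that of [j]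
   to [B] are occupied. In rows [B.-1] and [B], the only unpaired cells of row
   [B] are then those labeled [j], and [e_(B.-1)] lowers them from right to
   left. *)

(** * The vertical pairing and its height function *)

Lemma iter_increasing_fix (T : Type) (f : T -> T) (mu : T -> nat) (N : nat)
    (x : T) :
  (forall y, f y = y \/ mu y < mu (f y)) -> (forall y, mu y <= N) ->
  f (iter N f x) = iter N f x.
Proof.
move=> incr bnd; have [//|lt_mu] := incr (iter N f x).
have ind k : f (iter k f x) = iter k f x \/ k <= mu (iter k f x).
  elim: k => [|k [fixk|le_k]] /=; [by right|by left; rewrite !fixk|].
  have [eqf|lt_k] := incr (iter k f x); first by left; rewrite !eqf.
  by right; apply: leq_ltn_trans lt_k.
have [//|le_N] := ind N.
have := leq_ltn_trans le_N (leq_trans lt_mu (bnd _)).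
by rewrite ltnn.
Qed.

Section VerticalPairing.
Variables (D : diagram) (i : nat).

(* Reading the columns from left to right, a cell of row [i] is an opening
   and one of row [i.+1] a closing parenthesis; a closing one is
   unmatched iff it takes the height to a new strict minimum. *)
Fixpoint height (x : nat) : int :=
  if x is y.+1 then
    (height y + (((y, i) \in D) : nat)%:Z - (((y, i.+1) \in D) : nat)%:Z)%R
  else 0%R.

Arguments height : simpl never.

Lemma heightS (x : nat) :
  height x.+1 =
    (height x + (((x, i) \in D) : nat)%:Z - (((x, i.+1) \in D) : nat)%:Z)%R.
Proof. by []. Qed.

(** The invariant of the iteration. The equation between heights says that the columns from that of
    [x] through that of [y] contain as many opening as closing parentheses. *)
Definition coherent (P : pairing) : Prop :=
  column_pairs D i `<=` P /\
  forall x y : nat * nat, (x, y) \in P ->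
    [/\ x \in D /\ x.2 = i, y \in D /\ y.2 = i.+1,
        x.1 = y.1 \/ (x.1 < y.1 /\ height y.1.+1 = height x.1) &
        forall z : nat * nat, z \in D -> z.2 = i \/ z.2 = i.+1 ->
          x.1 < z.1 < y.1 ->
          paired P z].

Lemma pairedP (P : pairing) (z : cell) :
  reflect (exists w : nat * nat, (z, w) \in P \/ (w, z) \in P) (paired P z).
Proof.
apply: (iffP hasP) => [[[u v] uvP /orP[]/eqP ->]|[w [zP|zP]]].
- by exists v; left.
- by exists u; right.
- by exists (z, w) => //=; rewrite eqxx.
- by exists (w, z) => //=; rewrite eqxx orbT.
Qed.

Lemma pairedS (P Q : pairing) (z : cell) :
  P `<=` Q -> paired P z -> paired Q z.
Proof.
move=> /fsubsetP sPQ /pairedP[w [zP|zP]]; apply/pairedP; exists w.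
- by left; apply: sPQ.
- by right; apply: sPQ.
Qed.

Lemma mem_column_pairs (c : nat) :
  (c, i) \in D -> (c, i.+1) \in D -> ((c, i), (c, i.+1)) \in column_pairs D i.
Proof.
by move=> lo up; rewrite !inE /= lo up /row /col /= !eqxx.
Qed.

Lemma unpaired_lower_heightS (P : pairing) (c : nat) : coherent P ->
  (c, i) \in D -> ~~ paired P (c, i) -> height c.+1 = (height c + 1)%R.
Proof.
move=> [/fsubsetP colP _] lo /pairedP npc; rewrite heightS lo.
case: (boolP ((c, i.+1) \in D)) => [up|]; last by lia.
by case: npc; exists (c, i.+1); left; apply/colP/mem_column_pairs.
Qed.

Lemma unpaired_upper_heightS (P : pairing) (c : nat) : coherent P ->
  (c, i.+1) \in D -> ~~ paired P (c, i.+1) -> height c.+1 = (height c - 1)%R.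
Proof.
move=> [/fsubsetP colP _] up /pairedP npc; rewrite heightS up.
case: (boolP ((c, i) \in D)) => [lo|]; last by lia.
by case: npc; exists (c, i); right; apply/colP/mem_column_pairs.
Qed.

(** Go from [y] to the left. Only a lone opening at [z] could spoil the bound; it is paired with a
    closing at some [v], and [z] and [v.+1] have equal heights. Here [v < y]: otherwise [(y, i.+1)]
    would be its partner or would lie strictly inside the pair, hence be paired. *)
Lemma height_le_before (P : pairing) (a y : nat) : coherent P ->
  (y, i.+1) \in D -> ~~ paired P (y, i.+1) ->
  (forall z, a <= z < y -> (z, i) \in D -> paired P (z, i)) ->
  forall z, a <= z <= y -> (height y <= height z)%R.
Proof.
move=> cohP up npy all_paired z.
move: {2}(y - z) (leqnn (y - z)) => k; elim: k z => [|k IH] z le_k.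
  by move=> le_z; have -> : z = y by lia.
move=> /andP[le_az le_zy]; have [->|ne_zy] := eqVneq z y; first by lia.
have IH1 : (height y <= height z.+1)%R by apply: IH; lia.
case: (boolP ((z, i) \in D)) => [lo|lo]; last first.
  by move: IH1; rewrite heightS (negPf lo); lia.
case: (boolP ((z, i.+1) \in D)) => [up'|up'].
  by move: IH1; rewrite heightS lo up'; lia.
have /pairedP[[v r] [zP|zP]] : paired P (z, i) by apply: all_paired => //; lia.
  have [_ /= [vD er] hv btw] := cohP.2 _ _ zP; rewrite /= in er hv btw; subst r.
  case: hv => [ezv|[lt_zv <-]]; first by rewrite ezv vD in up'.
  apply: IH; first lia.
  apply/andP; split; first lia.
  have [//|lt_yv|eyv] := ltngtP v y.
    by move/negP: npy; case; apply: btw => //=; [right|lia].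
  by case/pairedP: npy; exists (z, i); right; rewrite -eyv.
have [_ [_ /= er] _ _] := cohP.2 _ _ zP; rewrite /= in er; lia.
Qed.

(** Mirror image of [height_le_before]: a lone closing is traded for its opening partner, which lies
    to the right of [x]. *)
Lemma height_ge_after (P : pairing) (x b : nat) : coherent P ->
  (x, i) \in D -> ~~ paired P (x, i) ->
  (forall z, x < z < b -> (z, i.+1) \in D -> paired P (z, i.+1)) ->
  forall z, x < z <= b -> (height x.+1 <= height z)%R.
Proof.
move=> cohP lo npx all_paired z; elim/ltn_ind: z => -[//|z] IH /andP[lt_xz le_zb].
have [->|ne_xz] := eqVneq z x; first by lia.
have IH1 : (height x.+1 <= height z)%R by apply: IH; lia.
case: (boolP ((z, i.+1) \in D)) => [up|up]; last first.
  by move: IH1; rewrite [height z.+1]heightS (negPf up); lia.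
case: (boolP ((z, i) \in D)) => [lo'|lo'].
  by move: IH1; rewrite [height z.+1]heightS lo' up; lia.
have /pairedP[[u r] [zP|zP]] : paired P (z, i.+1) by apply: all_paired => //; lia.
  by have [[_ /= er] _ _ _] := cohP.2 _ _ zP; rewrite /= in er; lia.
have [[uD /= er] _ hu btw] := cohP.2 _ _ zP; rewrite /= in er hu btw; subst r.
case: hu => [euz|[lt_uz ->]]; first by rewrite -euz uD in lo'.
apply: IH; first lia.
have [lt_ux|lt_xu|eux] := ltngtP u x; last 2 first.
- by lia.
- by case/pairedP: npx; exists (z, i.+1); left; rewrite -eux.
by move/negP: npx; case; apply: btw => //=; [left|lia].
Qed.

(** All cells strictly between are paired, so the two preceding bounds show that these columns
    balance; the lone opening at [x] and the lone closing at [y] then cancel. *)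
Lemma can_pair_height (P : pairing) (x y : cell) : coherent P ->
  x \in D -> y \in D -> can_pair D i P x y ->
  height y.1.+1 = height x.1.
Proof.
case: x y => [x r] [y s] cohP /= xD yD.
case/and5P=> [/eqP er /eqP es lt_xy npx /andP[npy /allP btw]].
rewrite /col /row /= in er es lt_xy btw *; subst r s.
have paired_btw z s : x < z < y -> s = i \/ s = i.+1 -> (z, s) \in D ->
    paired P (z, s).
  move=> lt_z es zD; have /implyP := btw _ zD; apply; rewrite /= lt_z andbT.
  by case: es => ->; rewrite eqxx ?orbT.
have le1 : (height y <= height x.+1)%R.
  apply: (@height_le_before P x.+1) => //; last by lia.
  by move=> z lt_z; apply: paired_btw => //; left.
have le2 : (height x.+1 <= height y)%R.
  apply: (@height_ge_after P x y) => //; last by lia.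
  by move=> z lt_z; apply: paired_btw => //; right.
rewrite (unpaired_upper_heightS cohP yD npy).
by rewrite (unpaired_lower_heightS cohP xD npx) in le1 le2; lia.
Qed.

Lemma coherent_step (P : pairing) : coherent P -> coherent (pairing_step D i P).
Proof.
move=> cohP; have sPQ : P `<=` pairing_step D i P by apply: fsubsetUl.
split; first exact: fsubset_trans cohP.1 sPQ.
move=> x y; rewrite inE => /orP[xyP|].
  have [xD yD hxy btw] := cohP.2 _ _ xyP; split=> // z zD rz lt_z.
  by apply: pairedS sPQ _; apply: btw.
rewrite !inE /= => /andP[/andP[xD yD] cp].
have hxy := can_pair_height cohP xD yD cp.
case/and5P: cp => [/eqP er /eqP es lt_xy _ /andP[_ /allP btw]]; split=> //.
  by right.
move=> z zD rz lt_z; apply: pairedS sPQ _.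
by have /implyP := btw _ zD; apply; rewrite /row /col lt_z andbT; case: rz => ->;
  rewrite eqxx ?orbT.
Qed.

Lemma coherent_column_pairs : coherent (column_pairs D i).
Proof.
split=> // -[x r] [y s]; rewrite !inE /= /row /col /=.
move=> /andP[/andP[xD yD] /and3P[/eqP er /eqP es /eqP ec]].
split=> //; first by left.
by move=> z _ _; rewrite ec => /andP[lt1 lt2]; have := ltn_trans lt1 lt2; rewrite ltnn.
Qed.

Lemma coherent_vertical_pairing : coherent (vertical_pairing D i).
Proof.
rewrite /vertical_pairing; elim: #|` D| => [|k IH] /=.
  exact: coherent_column_pairs.
exact: coherent_step.
Qed.

(** The number of paired cells of [D] is at most the number of iterations, and a step that changes
    the pairing increases it. *)
Lemma vertical_pairing_fix :
  pairing_step D i (vertical_pairing D i) = vertical_pairing D i.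
Proof.
apply: (@iter_increasing_fix _ _
  (fun P => #|` [fset z in D | paired P z]|)) => P; last first.
  by apply: fsubset_leq_card; apply/fsubsetP => z; rewrite !inE => /andP[].
have sPQ : P `<=` pairing_step D i P by apply: fsubsetUl.
have [eqP'|neqP] := eqVneq (pairing_step D i P) P; [by left|right].
have : ~~ (pairing_step D i P `<=` P).
  by apply: contra neqP => sQP; rewrite eqEfsubset sQP.
case/fsubsetPn=> -[x y].
rewrite !inE /= => /orP[->//|/andP[/andP[xD yD] cp]] _.
apply: fproper_ltn_card; rewrite fproperE; apply/andP; split.
  by apply/fsubsetP => z; rewrite !inE /= => /andP[-> /(pairedS sPQ)].
apply/fsubsetPn; exists x; rewrite !inE /= xD /=.
  by apply/pairedP; exists y; left; rewrite !inE /= xD yD cp orbT.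
by case/and5P: cp.
Qed.

(** An unpaired opening to the left of an unpaired closing, at the least distance, would have no
    unpaired cell strictly between, so one more step would pair the two. *)
Lemma fix_unpaired_order (P : pairing) (x y : nat) : coherent P ->
  pairing_step D i P = P ->
  (x, i) \in D -> (y, i.+1) \in D ->
  ~~ paired P (x, i) -> ~~ paired P (y, i.+1) -> y <= x.
Proof.
move=> cohP fixP; move: {2}(y - x) (leqnn (y - x)) => k.
elim: k x y => [|k IH] x y le_k; first by lia.
move=> xD yD npx npy; rewrite leqNgt; apply/negP => lt_xy.
have cp : can_pair D i P (x, i) (y, i.+1).
  apply/and5P; split=> //; rewrite npy; apply/allP => -[z r] zD.
  apply/implyP => /andP[/orP[]/eqP]; rewrite /row /col /= => er lt_z; subst r.
    by apply/negPn/negP => npz; have := IH z y _ zD yD npz npy; lia.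
  by apply/negPn/negP => npz; have := IH x z _ xD zD npx npz; lia.
move/pairedP: npx; case; exists (y, i.+1); left.
by rewrite -fixP !inE /= xD yD cp orbT.
Qed.

(** A partner in an earlier column would have the height of [c.+1], against the strict minimum. *)
Lemma record_unpaired (c : nat) : (c, i) \notin D ->
  (forall z, z <= c -> (height c.+1 < height z)%R) ->
  ~~ paired (vertical_pairing D i) (c, i.+1).
Proof.
move=> nlo low; apply/negP => /pairedP[[x r] [xP|xP]].
  by have [[_ /= er] _ _ _] := coherent_vertical_pairing.2 _ _ xP; rewrite /= in er; lia.
have [[xD /= er] _ hx _] := coherent_vertical_pairing.2 _ _ xP.
rewrite /= in er hx; subst r; case: hx => [exc|[lt_xc hx]].
  by rewrite -exc xD in nlo.
by have := low x (ltnW lt_xc); lia.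
Qed.

(** By [fix_unpaired_order] every opening to the left is paired, so [height_le_before] applies from
    column 0 on. *)
Lemma unpaired_record (c : nat) : (c, i.+1) \in D ->
  ~~ paired (vertical_pairing D i) (c, i.+1) ->
  forall z, z <= c -> (height c.+1 < height z)%R.
Proof.
move=> up npc z le_z; have cohV := coherent_vertical_pairing.
rewrite (unpaired_upper_heightS cohV up npc).
suff : (height c <= height z)%R by lia.
apply: (@height_le_before _ 0 c cohV up npc) => [w lt_w wD|]; last by lia.
apply/negPn/negP => npw.
by have := fix_unpaired_order cohV vertical_pairing_fix wD up npw npc; lia.
Qed.

(** The first height condition makes the cell unpaired. By the second, no cell of row [i.+1] further
    right reaches a new strict minimum, so none of them is unpaired. *)
Lemma raise_record (c : nat) :
  (c, i.+1) \in D -> (c, i) \notin D ->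
  (forall z, z <= c -> (height c.+1 < height z)%R) ->
  (forall x, c < x -> (x, i.+1) \in D -> (height c.+1 <= height x.+1)%R) ->
  raise i D = Some ((c, i) |` (D `\ (c, i.+1))).
Proof.
move=> up nlo low after; rewrite /raise.
set U := [fset y in D | _].
have cU : (c, i.+1) \in U by rewrite !inE /= up eqxx record_unpaired.
case: eqP => [U0|_]; first by rewrite U0 inE in cU.
suff -> : \max_(y <- U) col y = c by [].
apply/eqP; rewrite eqn_leq; apply/andP; split.
  apply/bigmax_leqP_seq => -[x r]; rewrite !inE /= => /and3P[xD /eqP er npx] _.
  rewrite /row /col /= in er *; subst r; rewrite leqNgt; apply/negP => lt_cx.
  by have := after x lt_cx xD; have := unpaired_record xD npx lt_cx; lia.
exact: (@leq_bigmax_seq _ _ xpredT col _ cU isT).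
Qed.

End VerticalPairing.

(** * Tableaux as functions giving the rows of the labels *)

Section Tableaux.
Variable a : seq nat.
Local Notation n := (size a).
Local Notation M := (max_part a).

Definition present (l c : nat) : bool := M - part a l < c <= M.

(** [b = id] gives the lock Kohnert tableaux; the induction works with smaller [b]. Values of [f]
    where the label is absent are unconstrained. *)
Record valid (b : nat -> nat) (f : nat -> nat -> nat) : Prop := Valid {
  valid_gt0 : forall l c, present l c -> 0 < f l c;
  valid_flag : forall l c, present l c -> f l c <= b l;
  valid_descend : forall l c c', present l c -> c <= c' <= M -> f l c' <= f l c;
  valid_strict : forall l m c, present l c -> present m c -> l < m ->
    f l c < f m c
}.

Definition label_cells (f : nat -> nat -> nat) : seq cell :=
  [seq (p.2, f p.1 p.2) | p <- [seq (l, c) | l <- iota 1 n, c <- iota 1 M]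
     & present p.1 p.2].

(** The label of a cell is recovered by searching for an [l] that [f] places there; when [f] is
    valid there is only one. *)
Definition tab (f : nat -> nat -> nat) : labeled_diagram :=
  [fmap x : [fset x in label_cells f] =>
    head 0 [seq l <- iota 1 n |
      present l (val x).1 && (f l (val x).1 == (val x).2)]].

Lemma part_le_max (l : nat) : part a l <= M.
Proof.
case: l => [|l] //; rewrite /part /=.
have [lt_l|ge_l] := ltnP l n; last by rewrite nth_default.
by rewrite /max_part; apply: (@leq_bigmax_seq _ _ xpredT id) => //; apply: mem_nth.
Qed.

Lemma part_bound (l : nat) : 0 < part a l -> 0 < l <= n.
Proof.
case: l => [|l] //; rewrite /part /= => pos.
by rewrite ltnNge; apply: contraTN pos => ge_l; rewrite nth_default.
Qed.

Lemma present_bound (l c : nat) : present l c -> 0 < l <= n.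
Proof.
move=> /andP[lt_c le_c]; apply: part_bound; have := part_le_max l; lia.
Qed.

Lemma present_max (l c c' : nat) : present l c -> c <= c' <= M -> present l c'.
Proof. by rewrite /present; lia. Qed.

Lemma label_cellsP (f : nat -> nat -> nat) (c r : nat) :
  reflect (exists2 l, present l c & f l c = r) ((c, r) \in label_cells f).
Proof.
apply: (iffP mapP) => [[[l d]]|[l pl <-]].
  by rewrite mem_filter /= => /andP[pl _] [-> ->]; exists l.
exists (l, c) => //; rewrite mem_filter; apply/andP; split=> //.
apply/allpairsPdep; exists l, c; split=> //; rewrite mem_iota.
  by have := present_bound pl; lia.
by move: pl; rewrite /present; lia.
Qed.

Lemma valid_inj (b : nat -> nat) (f : nat -> nat -> nat) (l m c : nat) :
  valid b f -> present l c -> present m c -> f l c = f m c -> l = m.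
Proof.
move=> vf pl pm ef; have [lt_lm|lt_ml|//] := ltngtP l m.
  by have := valid_strict vf pl pm lt_lm; rewrite ef ltnn.
by have := valid_strict vf pm pl lt_ml; rewrite ef ltnn.
Qed.

Lemma mem_tab (f : nat -> nat -> nat) (c r : nat) :
  reflect (exists2 l, present l c & f l c = r) ((c, r) \in domf (tab f)).
Proof. by rewrite inE; apply: label_cellsP. Qed.

Lemma tabP (b : nat -> nat) (f : nat -> nat -> nat) (c r l : nat) :
  valid b f -> has_label (tab f) (c, r) l <-> present l c /\ f l c = r.
Proof.
move=> vf; rewrite /has_label.
have head_label m : present m c -> f m c = r ->
    head 0 [seq l <- iota 1 n | present l c && (f l c == r)] = m.
  move=> pm fm; set s := filter _ _.
  have ms : m \in s.
    by rewrite mem_filter pm fm eqxx mem_iota; have := present_bound pm; lia.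
  have : head 0 s \in s by case: (s) ms => //= k s' _; rewrite inE eqxx.
  rewrite mem_filter => /andP[/andP[ph /eqP fh] _].
  by apply: (valid_inj vf ph pm); rewrite fh.
split=> [|[pl fl]].
  case: fndP => [x|//]; rewrite ffunE => -[<-].
  by have /mem_tab[m pm fm] := x; rewrite (head_label m).
have x : (c, r) \in domf (tab f) by apply/mem_tab; exists l.
by rewrite in_fnd ffunE; congr Some; apply: head_label.
Qed.

Lemma tab_ext (b b' : nat -> nat) (f g : nat -> nat -> nat) :
  valid b f -> valid b' g -> (forall l c, present l c -> f l c = g l c) ->
  tab f = tab g.
Proof.
move=> vf vg fg; apply/fmapP => -[c r].
apply/eqP; case E: ((tab f).[? _]) => [l|].
  have /(tabP _ _ _ vf)[pl fl] : has_label (tab f) (c, r) l by [].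
  have /(tabP _ _ _ vg) : present l c /\ g l c = r by rewrite -fg.
  by rewrite /has_label => ->.
case E': ((tab g).[? _]) => [l|//].
have /(tabP _ _ _ vg)[pl fl] : has_label (tab g) (c, r) l by [].
have /(tabP _ _ _ vf) : present l c /\ f l c = r by rewrite fg.
by rewrite /has_label E.
Qed.

(* In each column the labels are known, and they increase with the row. *)
Lemma tab_domf_inj (b b' : nat -> nat) (f g : nat -> nat -> nat) :
  valid b f -> valid b' g -> domf (tab f) = domf (tab g) -> tab f = tab g.
Proof.
move=> vf vg dfg; apply: (tab_ext vf vg) => l c.
elim/ltn_ind: l => l IH pl.
have [lt_fg|lt_gf|//] := ltngtP (f l c) (g l c).
  have : (c, f l c) \in domf (tab f) by apply/mem_tab; exists l.
  rewrite dfg => /mem_tab[m pm gm].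
  have [lt_ml|lt_lm|eml] := ltngtP m l.
  - by have := valid_strict vf pm pl lt_ml; rewrite IH // gm ltnn.
  - by have := valid_strict vg pl pm lt_lm; lia.
  - by rewrite eml in gm; lia.
have : (c, g l c) \in domf (tab g) by apply/mem_tab; exists l.
rewrite -dfg => /mem_tab[m pm gm].
have [lt_ml|lt_lm|eml] := ltngtP m l.
- by have := valid_strict vg pm pl lt_ml; rewrite -IH // gm ltnn.
- by have := valid_strict vf pl pm lt_lm; lia.
- by rewrite eml in gm; lia.
Qed.

Lemma card_label_strip (f : nat -> nat) (l : nat) :
  #|` [fset (c, f c) | c in iota (M - part a l).+1 (part a l)]| = part a l.
Proof.
rewrite card_imfset /= => [|c d [] //].
by rewrite undup_id ?iota_uniq // size_iota.
Qed.

Lemma mem_label_strip (f : nat -> nat) (l c r : nat) :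
  ((c, r) \in [fset (c, f c) | c in iota (M - part a l).+1 (part a l)]) =
    present l c && (f c == r).
Proof.
apply/imfsetP/andP => /= [[d]|[pl /eqP <-]]; last first.
  by exists c => //; rewrite mem_iota; move: pl (part_le_max l); rewrite /present; lia.
rewrite mem_iota => dl [-> ->]; split=> //.
by move: dl (part_le_max l); rewrite /present; lia.
Qed.

Lemma LKT_tab (f : nat -> nat -> nat) : valid id f -> LKT a (tab f).
Proof.
move=> vf; split.
- move=> [c r] /mem_tab[l pl <-]; rewrite /col /row /=.
  by split; [move: pl; rewrite /present; lia|apply: (valid_gt0 vf)].
- move=> l; rewrite -[RHS](card_label_strip (f l)); congr (#|` _|).
  apply/fsetP => -[c r]; rewrite mem_label_strip !inE /=.
  apply/idP/idP => [/andP[_ /eqP /(tabP _ _ _ vf)[-> ->]]|/andP[pl /eqP fl]].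
    by rewrite eqxx.
  have /(tabP _ _ _ vf) -> : present l c /\ f l c = r by [].
  by rewrite eqxx andbT; apply/label_cellsP; exists l.
- move=> l c _ bc; have pl : present l c by move: bc; rewrite /present; lia.
  exists (f l c); split; first by apply/(tabP _ _ _ vf).
  by move=> r /(tabP _ _ _ vf)[].
- by move=> [c r] l /(tabP _ _ _ vf)[pl <-]; apply: (valid_flag vf).
- move=> [c r] [c' r'] l /(tabP _ _ _ vf)[pl <-] /(tabP _ _ _ vf)[pl' <-].
  rewrite /col /row /= => lt_c; apply: (valid_descend vf) => //.
  by move: pl'; rewrite /present; lia.
- move=> [c r] [c' r'] l m /(tabP _ _ _ vf)[pl <-] /(tabP _ _ _ vf)[pm <-].
  rewrite /col /row /= => ec; subst c' => lt_r.
  have [//|lt_ml|elm] := ltngtP l m.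
    by have := valid_strict vf pm pl lt_ml; lia.
  by rewrite elm ltnn in lt_r.
Qed.

Lemma tab_of_LKT (T : labeled_diagram) :
  LKT a T -> exists2 f, valid id f & T = tab f.
Proof.
move=> [Tdiag Tcont Tcol Tflag Tdesc Tstrict].
(* The row of the cell labeled [l] in column [c]; the default 0 is returned only if there is
   none. *)
pose f l c := nth 0 [seq x.2 | x <- enum_fset (domf T)
  & (x.1 == c) && (T.[? x] == Some l)] 0.
have lab l c : present l c -> has_label T (c, f l c) l.
  move=> pl; have bl := present_bound pl.
  have [||r [Tr _]] := Tcol l c; [by lia|by move: pl; rewrite /present; lia|].
  have memr : r \in [seq x.2 | x <- enum_fset (domf T)
      & (x.1 == c) && (T.[? x] == Some l)].
    apply/mapP; exists (c, r) => //; rewrite mem_filter /= eqxx /= Tr eqxx /=.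
    by rewrite -fndSome Tr.
  have : f l c \in [seq x.2 | x <- enum_fset (domf T)
      & (x.1 == c) && (T.[? x] == Some l)].
    by apply: mem_nth; case: [seq _ | _ <- _ & _] memr.
  case/mapP => -[c' r']; rewrite mem_filter /= => /andP[/andP[/eqP -> /eqP lab] _] ->.
  by [].
have labP c r l : has_label T (c, r) l <-> present l c /\ f l c = r.
  split=> [Tr|[pl <-]]; last exact: lab.
  suff : (c, r) \in [fset (c, f l c) | c in iota (M - part a l).+1 (part a l)].
    by rewrite mem_label_strip => /andP[pl /eqP].
  (* The smaller set already has [part a l] elements, all that the content allows, so [l] occurs
     nowhere else. *)
  have sub : [fset (c, f l c) | c in iota (M - part a l).+1 (part a l)] `<=`
      [fset x in domf T | T.[? x] == Some l].
    apply/fsubsetP => -[d s]; rewrite mem_label_strip => /andP[pl /eqP <-].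
    by have := lab _ _ pl; rewrite /has_label !inE /= -fndSome => ->; rewrite eqxx.
  move/fsubset_leqif_cards: (sub) => [_]; rewrite card_label_strip Tcont eqxx.
  by move/esym/eqP ->; rewrite !inE /= -fndSome Tr eqxx.
have vf : valid id f.
  split=> [l c pl|l c pl|l c c' pl bc|l m c pl pm lt_lm].
  - by have [|//] := Tdiag (c, f l c); rewrite -fndSome lab.
  - exact: Tflag (lab _ _ pl).
  - have [->//|ne_c] := eqVneq c c'.
    apply: Tdesc (lab _ _ pl) (lab _ _ (present_max pl bc)) _.
    by rewrite /col /=; lia.
  - have [//|lt_ml|efl] := ltngtP (f l c) (f m c).
      by have := Tstrict _ _ _ _ (lab _ _ pm) (lab _ _ pl) erefl lt_ml; lia.
    have := lab _ _ pm; rewrite -efl /has_label (lab _ _ pl) => -[]; lia.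
exists f => //; apply/fmapP => -[c r].
case E: (T.[? _]) => [l|].
  by have /labP/(tabP _ _ _ vf) : has_label T (c, r) l by [].
case E': ((tab f).[? _]) => [l|//].
have /(tabP _ _ _ vf)/labP : has_label (tab f) (c, r) l by [].
by rewrite /has_label E.
Qed.

(** Reduces the lock operator to diagrams: whichever tableau is chosen on the raised diagram,
    [tab_domf_inj] identifies it with [tab g]. *)
Lemma lock_raise_tab (i : nat) (f g : nat -> nat -> nat) :
  valid id f -> valid id g ->
  raise i (domf (tab f)) = Some (domf (tab g)) ->
  lock_raise a i (tab f) = Some (tab g).
Proof.
move=> vf vg eqr; rewrite /lock_raise eqr.
case: pselect => [exU|[]]; last by exists (tab g); split=> //; apply: LKT_tab.
congr Some; case: cid => U /= [/tab_of_LKT[h vh ->]].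
by move=> dh; apply: (tab_domf_inj vh vg).
Qed.

End Tableaux.

(** * Links that move a single cell, and the rows forced by ranks *)

Lemma last_minimum (h : nat -> int) (c : nat) : exists y,
  [/\ y <= c, forall z, z <= y -> (h y <= h z)%R &
      forall z, y < z <= c -> (h y < h z)%R].
Proof.
elim: c => [|c [y [le_yc min_y last_y]]].
  by exists 0; split=> // z; [rewrite leqn0 => /eqP ->|lia].
case: (boolP (h c.+1 <= h y)%R) => [le_h|lt_h].
  exists c.+1; split=> // z; last by lia.
  move=> le_z; have [->//|ne_z] := eqVneq z c.+1.
  have [le_zy|lt_yz] := leqP z y; first by have := min_y z le_zy; lia.
  by have := last_y z; rewrite lt_yz => /(_ ltac:(lia)); lia.
exists y; split; [exact: leqW|by []|].
move=> z /andP[lt_yz le_z]; have [->|ne_z] := eqVneq z c.+1; first by lia.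
by apply: last_y; lia.
Qed.

Section Connectivity.
Variable a : seq nat.
Local Notation n := (size a).
Local Notation M := (max_part a).
Local Notation dom f := (domf (tab a f)).

Definition linked : labeled_diagram -> labeled_diagram -> Prop :=
  clos_refl_sym_trans labeled_diagram (fun T U => [/\ LKT a T, LKT a U &
    exists i, 1 <= i < n /\ lock_raise a i T = Some U]).

(** The height conditions make the cell of [m] in column [c] the rightmost unpaired one of row
    [i.+1]; validity of [g] makes the result a tableau. *)
Lemma raise_linked (f g : nat -> nat -> nat) (m c i : nat) :
  valid a id f -> valid a id g -> present a m c -> f m c = i.+1 -> g m c = i ->
  (forall l x, present a l x -> (l, x) <> (m, c) -> f l x = g l x) ->
  (forall z, z <= c -> (height (dom f) i c.+1 < height (dom f) i z)%R) ->
  (forall x, c < x -> (height (dom f) i c.+1 <= height (dom f) i x.+1)%R) ->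
  linked (tab a f) (tab a g).
Proof.
move=> vf vg pm fm gm fg low after.
have up : (c, i.+1) \in dom f by apply/mem_tab; exists m.
(* A label in this cell under [f] would share it with [m] under [g]. *)
have nlo : (c, i) \notin dom f.
  apply/negP => /mem_tab[l pl fl]; have [elm|nlm] := eqVneq l m.
    by rewrite elm fm in fl; lia.
  case/eqP: nlm; apply: (valid_inj vg pl pm).
  by rewrite -fg // ?fl // => -[elm]; rewrite elm fm in fl; lia.
apply: rst_step; split; [exact: LKT_tab|exact: LKT_tab|exists i; split].
  have := valid_flag vf pm; have := valid_gt0 vg pm; have := present_bound pm.
  by rewrite /= fm gm; lia.
apply: lock_raise_tab => //; rewrite (raise_record up nlo low) //.
  congr Some; apply/fsetP => -[x r]; rewrite in_fset1U in_fsetD1.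
  apply/idP/mem_tab => [/orP[/eqP[-> ->]|/andP[ne /mem_tab[l pl fl]]]|[l pl gl]].
  - by exists m.
  - exists l => //; rewrite -fg // => -[el ex]; subst l x.
    by rewrite -fl fm eqxx in ne.
  have [[el ex]|/eqP ne] := eqVneq (l, x) (m, c).
    by rewrite -gl el ex gm eqxx.
  apply/orP; right; apply/andP; split; last first.
    by apply/mem_tab; exists l => //; rewrite fg.
  apply/negP => /eqP[ex er]; subst x r; apply: ne; congr pair.
  by apply: (valid_inj vf pl pm); rewrite fm -er fg // => -[el]; subst l; lia.
by move=> x lt_cx _; apply: after.
Qed.

Definition upd (f : nat -> nat -> nat) (m c r : nat) : nat -> nat -> nat :=
  fun l x => if (l == m) && (x == c) then r else f l x.

Lemma upd_id (f : nat -> nat -> nat) (m c r : nat) : upd f m c r m c = r.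
Proof. by rewrite /upd !eqxx. Qed.

Lemma upd_neq (f : nat -> nat -> nat) (m c r l x : nat) :
  (l, x) <> (m, c) -> upd f m c r l x = f l x.
Proof. by rewrite /upd; case: andP => // -[/eqP -> /eqP ->] []. Qed.

Lemma mem_dom_upd (f : nat -> nat -> nat) (m c r x s : nat) :
  x <> c -> ((x, s) \in dom (upd f m c r)) = ((x, s) \in dom f).
Proof.
move=> ne; apply/mem_tab/mem_tab => -[l pl <-]; exists l => //;
  by rewrite upd_neq // => -[].
Qed.

(* The number of labels smaller than [l] that occur. *)
Fixpoint rank (l : nat) : nat :=
  if l is k.+1 then rank k + (0 < part a k) else 0.

Lemma rank_le (l m : nat) : l <= m -> rank l <= rank m.
Proof.
move=> /subnKC <-; elim: (m - l) => [|k IH]; first by rewrite addn0.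
by rewrite addnS /=; lia.
Qed.

Lemma rank_lt (l m : nat) : 0 < part a l -> l < m -> rank l < rank m.
Proof. by move=> pos /rank_le; apply: leq_trans; rewrite /= pos addn1. Qed.

Lemma present_pos (l c : nat) : present a l c -> 0 < part a l.
Proof. by rewrite /present; lia. Qed.

Lemma present_last (l : nat) : 0 < part a l -> present a l M.
Proof. by have := part_le_max a l; rewrite /present; lia. Qed.

(** Every label that occurs is present in column [M], where rows strictly increase with the label;
    by descent, a label is nowhere lower than in that column. *)
Lemma rank_lt_valid (b : nat -> nat) (f : nat -> nat -> nat) (l c : nat) :
  valid a b f -> present a l c -> rank l < f l c.
Proof.
move=> vf pl; have lM := present_last (present_pos pl).
apply: (@leq_trans (f l M)); last first.
  by apply: (valid_descend vf pl); move: pl; rewrite /present; lia.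
suff ind k m : k <= m -> present a m M -> rank k < f m M by apply: ind.
elim: k m => [|k IH] m le_km pm /=; first exact: (valid_gt0 vf pm).
case: (ltnP 0 (part a k)) => [pos|_]; last by rewrite addn0; apply: IH; lia.
have := IH k (leqnn k) (present_last pos).
by have := valid_strict vf (present_last pos) pm le_km; lia.
Qed.

Lemma valid_weaken (b b' : nat -> nat) (f : nat -> nat -> nat) :
  (forall l, b l <= b' l) -> valid a b f -> valid a b' f.
Proof.
move=> le_b [f0 fb fd fs]; split=> // l c pl.
exact: leq_trans (fb l c pl) (le_b l).
Qed.

(** * Decreasing the bound of the smallest label that is not forced *)

Section PushDown.
Variables (b : nat -> nat) (j : nat).
Hypothesis b_id : forall l, b l <= l.
Hypothesis b_mono : forall l m,
  0 < part a l -> 0 < part a m -> l <= m -> b l <= b m.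
Hypothesis j_pos : 0 < part a j.
Hypothesis b_below : forall l, 0 < part a l -> l < j -> b l <= (rank l).+1.
Hypothesis rank_j : (rank j).+1 < b j.

Lemma label_ge_j (f : nat -> nat -> nat) (l c : nat) :
  valid a b f -> present a l c -> rank j < f l c -> j <= l.
Proof.
move=> vf pl lt_r; rewrite leqNgt; apply/negP => lt_lj.
have pos := present_pos pl; have := valid_flag vf pl.
by have := b_below pos lt_lj; have := rank_lt pos lt_lj; lia.
Qed.

(* The move is at the last minimum [y] of the height function, the column of
   the leftmost unpaired cell of row [i]. *)
Lemma unblocked_raise (f : nat -> nat -> nat) (c i : nat) : valid a b f ->
  present a j c -> f j c <= i < b j ->
  (c, i) \in dom f -> (c, i.+1) \notin dom f ->
  (forall x, c < x -> ((x, i) \in dom f) = ((x, i.+1) \in dom f)) ->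
  exists m y, [/\ present a m y, f m y = i, valid a b (upd f m y i.+1) &
    linked (tab a f) (tab a (upd f m y i.+1))].
Proof.
move=> vf pj /andP[le_i lt_i] lo nup flat.
set h := height (dom f) i.
(* To the right of [c] the two rows agree, so the height stays constant and the last minimum up to
   [c] is the last one overall. *)
have h_after z : c < z -> h z = (h c + 1)%R.
  elim: z => // z IH le_z; have [ezc|ne] := eqVneq z c.
    by rewrite ezc /h heightS lo (negPf nup); lia.
  by rewrite /h heightS flat; [have := IH ltac:(lia); rewrite /h|]; lia.
have [y [le_yc min_y last_y0]] := last_minimum h c.
have last_y z : y < z -> (h y < h z)%R.
  move=> lt_z; have [le_z|lt_cz] := leqP z c.
    by apply: last_y0; rewrite lt_z.
  rewrite (h_after z) //; have [->|ne] := eqVneq y c; first by lia.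
  by have := last_y0 c; rewrite leqnn andbT => /(_ ltac:(lia)); lia.
(* The height rises just after [y], which only a lone opening in column [y] can cause. *)
have [ylo yup] : (y, i) \in dom f /\ (y, i.+1) \notin dom f.
  by have := last_y y.+1 (leqnn _); rewrite /h heightS; do 2 case: (_ \in _); lia.
have /mem_tab[m pm fm] := ylo.
have le_jm : j <= m.
  by apply: (label_ge_j vf pm); have := rank_lt_valid vf pj; lia.
have le_bm : i.+1 <= b m.
  exact: leq_trans lt_i (b_mono j_pos (present_pos pm) le_jm).
have above l : present a l y -> m < l -> i.+1 < f l y.
  move=> pl lt_ml; have := valid_strict vf pm pl lt_ml; rewrite fm leq_eqVlt.
  by case/orP=> // /eqP el; case/negP: yup; apply/mem_tab; exists l.
(* Otherwise [m] lies in row [i] in column [w = y - 1] too. Minimality at [y] then requires a cell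
   above it, whose label [m'] exceeds [m] and descends to row at most [i.+1] in column [y], against
   [above]. *)
have left_gt x : x < y -> present a m x -> i < f m x.
  move=> lt_xy px; rewrite ltnNge; apply/negP => le_fx.
  have le_yM : y <= M by move: pm; rewrite /present; lia.
  have [w ey] : exists w, y = w.+1 by exists y.-1; lia.
  have pw : present a m w by apply: present_max px _; lia.
  have fw : f m w = i.
    apply/eqP; rewrite eqn_leq -{2}fm; apply/andP; split.
      by apply: leq_trans le_fx; apply: (valid_descend vf px); lia.
    by apply: (valid_descend vf pw); lia.
  have := min_y w ltac:(lia); rewrite /h {1}ey heightS.
  have -> : (w, i) \in dom f by apply/mem_tab; exists m.
  case: (boolP (_ \in _)) => [/mem_tab[m' pm' fm'] _|_]; last by lia.
  have lt_m : m < m'.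
    rewrite ltnNge leq_eqVlt; apply/negP => /orP[/eqP em|lt_m].
      by move: fm'; rewrite em fw => /eqP; rewrite ltn_eqF.
    by have := valid_strict vf pm' pw lt_m; rewrite fm' fw ltnNge leqnSn.
  have pm'y : present a m' y by apply: present_max pm' _; lia.
  have := above m' pm'y lt_m; rewrite ltnNge -fm' => /negP; case.
  by apply: (valid_descend vf pm'); rewrite ey leqnSn -ey.
have vg : valid a b (upd f m y i.+1).
  split.
  - by move=> l x pl; rewrite /upd; case: ifP => // _; apply: (valid_gt0 vf).
  - move=> l x pl; rewrite /upd; case: ifP => [/andP[/eqP -> _] //|_].
    exact: (valid_flag vf).
  - move=> l x x' pl le_x; have := valid_descend vf pl le_x; rewrite /upd.
    case: (l =P m) => //= el; subst l.
    case: (x' =P y) => [ex'|_]; case: (x =P y) => [ex|ne] //=; subst.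
      by move=> _; apply: left_gt => //; lia.
    by lia.
  - move=> l l' x pl pl' lt_l; have := valid_strict vf pl pl' lt_l; rewrite /upd.
    case: (x =P y) => [ex|_]; last by rewrite !andbF.
    subst x; rewrite !andbT; case: (l =P m) => [el|_]; case: (l' =P m) => [el'|_] //.
    - by lia.
    - by subst l => _; apply: above.
    - by subst l'; rewrite fm; lia.
(* The operator takes the new tableau back to the old one. *)
exists m, y; split=> //; apply: rst_sym.
have hg_before z : z <= y -> height (dom (upd f m y i.+1)) i z = h z.
  elim: z => // z IH lt_z; rewrite /h !heightS IH 1?ltnW // !mem_dom_upd //; lia.
have gup : (y, i.+1) \in dom (upd f m y i.+1) by apply/mem_tab; exists m; rewrite // upd_id.
have gnlo : (y, i) \notin dom (upd f m y i.+1).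
  apply/negP => /mem_tab[l pl]; have [->|ne] := eqVneq l m.
    by rewrite upd_id; lia.
  rewrite upd_neq => [fl|[]]; last by apply/eqP.
  by case/eqP: ne; apply: (valid_inj vf pl pm); rewrite fm.
(* Column [y] contributed 1 before the move and contributes -1 after it. *)
have hg_after z : y < z -> height (dom (upd f m y i.+1)) i z = (h z - 2)%R.
  elim: z => // z IH lt_z; rewrite /h !heightS; have [ezy|ne] := eqVneq z y.
    subst z; rewrite hg_before // gup ylo (negPf gnlo) (negPf yup) /h; lia.
  have lt_yz : y < z by rewrite ltn_neqAle eq_sym ne.
  by rewrite !mem_dom_upd ?IH // /h; [clear; lia|apply/eqP|apply/eqP].
apply: (@raise_linked _ _ m y i).
- exact: valid_weaken b_id vg.
- exact: valid_weaken b_id vf.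
- by [].
- by rewrite upd_id.
- by [].
- by move=> l x _; apply: upd_neq.
- move=> z le_z; rewrite heightS gup (negPf gnlo) !hg_before //.
  by have := min_y z le_z; lia.
- move=> x lt_x; rewrite !hg_after //; last lia.
  have := last_y x.+1 (leqW lt_x); rewrite [h y.+1]heightS ylo (negPf yup) -/h.
  by clear; lia.
Qed.

(** Termination measure for the upward moves. Absent labels enter the sum too, but no move changes
    their terms. *)
Definition deficit (f : nat -> nat -> nat) : nat :=
  \sum_(p : 'I_n.+1 * 'I_M.+1) (n - f p.1 p.2).

Lemma deficit_upd (f : nat -> nat -> nat) (m c : nat) :
  present a m c -> f m c < n -> deficit (upd f m c (f m c).+1) < deficit f.
Proof.
move=> pm lt_f; have lt_m : m < n.+1 by have := present_bound pm; lia.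
have lt_c : c < M.+1 by move: pm; rewrite /present; lia.
rewrite /deficit (bigD1 (Ordinal lt_m, Ordinal lt_c)) //=.
rewrite [ltnRHS](bigD1 (Ordinal lt_m, Ordinal lt_c)) //= upd_id.
rewrite (eq_bigr (fun p : 'I_n.+1 * 'I_M.+1 => n - f p.1 p.2)) ?ltn_add2r.
  by rewrite subnS prednK // subn_gt0.
move=> [l x] /eqP ne; rewrite upd_neq //= => -[el ex]; apply: ne.
by congr pair; apply: val_inj.
Qed.

(** Induction on the deficit: while some column with label [j] has a hole between [j] and row [b j],
    the lowest hole of the rightmost such column provides a move by [unblocked_raise]. *)
Lemma saturate (f : nat -> nat -> nat) : valid a b f -> exists g,
  [/\ valid a b g, linked (tab a f) (tab a g) &
      forall c r, present a j c -> g j c <= r <= b j -> (c, r) \in dom g].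
Proof.
have [k] := ubnP (deficit f); elim: k f => // k IH f lt_k vf.
pose hole c r := (f j c <= r) && ((c, r) \notin dom f).
pose bad c := present a j c && has (hole c) (iota 0 (b j).+1).
have [exbad|nobad] := boolP (has bad (iota 0 M.+1)); last first.
  exists f; split=> //; first exact: rst_refl.
  move=> c r pj /andP[le_r le_b]; apply/negPn/negP => nr.
  case/hasP: nobad; exists c.
    by rewrite mem_iota; move: pj; rewrite /present; clear; lia.
  rewrite /bad pj; apply/hasP; exists r; last by rewrite /hole le_r.
  by rewrite mem_iota; clear -le_b; lia.
have {exbad} exbad : exists c, bad c by case/hasP: exbad => c _; exists c.
have bnd c : bad c -> c <= M by case/andP => /andP[].
have [c /andP[pj hasr] maxc] := ex_maxnP exbad bnd.
have exr : exists r, hole c r by case/hasP: hasr => r _; exists r.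
have [r /andP[le_r nr] minr] := ex_minnP exr.
have le_b : r <= b j.
  case/hasP: hasr => s; rewrite mem_iota add0n => lt_s /minr le_rs.
  by clear -le_rs lt_s; lia.
case: r => [|i] in le_r nr minr le_b *.
  by have := valid_gt0 vf pj; clear -le_r; lia.
have le_i : f j c <= i.
  rewrite -ltnS ltn_neqAle le_r andbT; apply: contra nr => /eqP <-.
  by apply/mem_tab; exists j.
have lo : (c, i) \in dom f.
  apply/negPn/negP => ni; have := minr i; rewrite /hole le_i ni => /(_ isT).
  by rewrite ltnn.
(* Up to column [M] both rows are full, as [c] is the rightmost column with a hole; beyond [M] both
   are empty. *)
have flat x : c < x -> ((x, i) \in dom f) = ((x, i.+1) \in dom f).
  move=> lt_cx; have [le_x|lt_x] := leqP x M; last first.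
    by apply/mem_tab/mem_tab => -[l pl]; move: pl lt_x; rewrite /present; clear; lia.
  have px : present a j x by apply: present_max pj _; rewrite ltnW.
  have le_fx : f j x <= i.
    by apply: leq_trans le_i; apply: (valid_descend vf pj); rewrite ltnW.
  have full s : f j x <= s <= b j -> (x, s) \in dom f.
    move=> /andP[le_s le_sb]; apply/negPn/negP => ns.
    have : bad x.
      rewrite /bad px; apply/hasP; exists s; last by rewrite /hole le_s.
      by rewrite mem_iota; clear -le_sb; lia.
    by move/maxc; clear -lt_cx; lia.
  by rewrite !full //; apply/andP; split=> //; clear -le_fx le_b; lia.
have [m [y [pm fm vg lnk]]] :=
  unblocked_raise vf pj (introT andP (conj le_i le_b)) lo nr flat.
have lt_n : f m y < n.
  have := valid_flag vg pm; rewrite upd_id => le_bm.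
  have := present_bound pm; have := b_id m; rewrite fm; clear -le_bm; lia.
have [|g [vg' lnk' full]] := IH _ _ vg.
  by rewrite -fm; have := deficit_upd pm lt_n; clear -lt_k; lia.
by exists g; split=> //; apply: rst_trans lnk lnk'.
Qed.

(** Row [(b j).-1] is empty up to column [c], and to the right of [c] each cell of row [b j] has a
    cell just below it. So the cell of [j] in column [c] is the rightmost unpaired one of its
    row. *)
Lemma lower_step (f : nat -> nat -> nat) (c : nat) : valid a b f ->
  present a j c -> f j c = b j ->
  (forall x, present a j x -> f j x < b j -> (x, (b j).-1) \in dom f) ->
  (forall x, c < x -> present a j x -> f j x < b j) ->
  valid a b (upd f j c (b j).-1) /\
  linked (tab a f) (tab a (upd f j c (b j).-1)).
Proof.
move=> vf pj fj full low.
have [i bi] : exists i, b j = i.+1 by exists (b j).-1; move: rank_j; clear; lia.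
rewrite bi /= in fj full low *.
have lt_i : rank j < i by move: rank_j; rewrite bi; clear; lia.
have small l x : present a l x -> l < j -> f l x < i.
  move=> pl lt_lj; have pos := present_pos pl.
  have := valid_flag vf pl; have := b_below pos lt_lj; have := rank_lt pos lt_lj.
  by clear -lt_i; lia.
have vg : valid a b (upd f j c i).
  split.
  - move=> l x pl; rewrite /upd; case: ifP => _; last exact: (valid_gt0 vf).
    by clear -lt_i; lia.
  - move=> l x pl; rewrite /upd; case: ifP => [/andP[/eqP -> _]|_].
      by rewrite bi.
    exact: (valid_flag vf).
  - move=> l x x' pl le_x; have := valid_descend vf pl le_x; rewrite /upd.
    case: (l =P j) => //= el; subst l.
    case: (x' =P c) => [->|/eqP nec]; case: (x =P c) => [ex|_] //=.
      by rewrite fj; apply: ltnW.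
    move=> _; rewrite -ltnS; apply: low; last by apply: present_max pl le_x.
    by move: le_x nec; rewrite ex; clear; lia.
  - move=> l l' x pl pl' lt_l; have := valid_strict vf pl pl' lt_l; rewrite /upd.
    case: (x =P c) => [ex|_]; last by rewrite !andbF.
    subst x; rewrite !andbT; case: (l =P j) => [el|_]; case: (l' =P j) => [el'|_] //.
    - by move: lt_l; rewrite el el' ltnn.
    - by subst l; rewrite fj; apply: ltnW.
    - by subst l' => _; apply: small.
(* Labels below [j] lie in rows less than [i]. Any other label in row [i] would descend to a row at
   most [i] in column [c], though [j] is in row [i.+1] there. *)
have empty x : x <= c -> (x, i) \notin dom f.
  move=> le_x; apply/negP => /mem_tab[l pl fl].
  have [lt_lj|le_jl] := ltnP l j; first by have := small l x pl lt_lj; rewrite fl ltnn.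
  have le_cM : x <= c <= M by move: pj; rewrite /present le_x => /andP[_ ->].
  have plc := present_max pl le_cM.
  have : f j c <= f l c.
    by move: le_jl; rewrite leq_eqVlt => /orP[/eqP <- //|/(valid_strict vf pj plc)/ltnW].
  rewrite fj => /leq_trans/(_ (valid_descend vf pl le_cM)).
  by rewrite fl ltnn.
have up : (c, i.+1) \in dom f by apply/mem_tab; exists j.
split=> //; apply: (@raise_linked _ _ j c i).
- exact: valid_weaken b_id vf.
- exact: valid_weaken b_id vg.
- by [].
- by [].
- by rewrite upd_id.
- by move=> l x _ ne; rewrite upd_neq.
- move=> z le_z; rewrite heightS up (negPf (empty c (leqnn c))).
  suff : (height (dom f) i c <= height (dom f) i z)%R by clear; lia.
  move: (empty) le_z; elim: (c) z => [|d IH] z nlo; first by rewrite leqn0 => /eqP ->.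
  have [->//|ne le_z] := eqVneq z d.+1; rewrite heightS (negPf (nlo d (leqnSn d))).
  have le_zd : z <= d by move: le_z ne; clear; lia.
  have := IH z (fun x le_x => nlo x (leqW le_x)) le_zd.
  by clear; lia.
- have cover x : c < x -> (x, i.+1) \in dom f -> (x, i) \in dom f.
    move=> lt_cx /mem_tab[l pl _].
    have px : present a j x.
      by apply: present_max pj _; rewrite ltnW //; case/andP: pl.
    by apply: full => //; apply: low.
  elim=> // x IH; rewrite ltnS leq_eqVlt => le_cx.
  have le_hx : (height (dom f) i c.+1 <= height (dom f) i x.+1)%R.
    by case/orP: le_cx => [/eqP ->|/IH].
  have lt_cx : c < x.+1 by rewrite ltnS leq_eqVlt.
  rewrite [height _ _ x.+2]heightS; move: le_hx; have := cover x.+1 lt_cx.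
  case: (_ \in _) => [->//|_]; first by clear; lia.
  by clear; lia.
Qed.

(** The columns are swept from right to left, since [lower_step] requires [j] to have left row [b j]
    further right. *)
Lemma lower_all (f : nat -> nat -> nat) : valid a b f ->
  (forall c, present a j c -> f j c < b j -> (c, (b j).-1) \in dom f) ->
  exists g, [/\ valid a b g, linked (tab a f) (tab a g) &
    forall c, present a j c -> g j c < b j].
Proof.
move=> vf full.
have : forall c, M < c -> present a j c -> f j c < b j.
  by move=> c lt_c /andP[_]; rewrite leqNgt lt_c.
(* The columns beyond [C] are those already swept. *)
move: (M) => C; elim: C f vf full => [|C IH] f vf full low.
  exists f; split=> //; first exact: rst_refl.
  by move=> c pc; apply: low => //; case/andP: pc => /(leq_ltn_trans (leq0n _)).
have [/andP[pC /eqP fC]|nC] := boolP (present a j C.+1 && (f j C.+1 == b j)).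
  have [vg lnk] := lower_step vf pC fC full low.
  have [||g [vg' lnk' low']] := IH _ vg; last first.
  - by exists g; split=> //; apply: rst_trans lnk lnk'.
  - move=> c lt_c pc; have [->|ne] := eqVneq c C.+1.
      by rewrite upd_id; move: rank_j; clear; lia.
    rewrite upd_neq => [|[ec]]; last by case/eqP: ne.
    by apply: low pc; move: lt_c ne; clear; lia.
  (* In the column just treated, the lowered cell itself occupies row [(b j).-1]. *)
  move=> c pc; have [->|/eqP ne] := eqVneq c C.+1.
    by move=> _; apply/mem_tab; exists j; rewrite // upd_id.
  by rewrite mem_dom_upd // upd_neq => [|[]//]; apply: full.
apply: IH => // c lt_c pc; have [ec|ne] := eqVneq c C.+1.
  subst c; rewrite pc /= in nC.
  by rewrite ltn_neqAle nC (valid_flag vf pc).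
by apply: low pc; move: lt_c ne; clear; lia.
Qed.

Lemma push_down (f : nat -> nat -> nat) : valid a b f -> exists g,
  valid a (fun l => if l == j then (b j).-1 else b l) g /\
  linked (tab a f) (tab a g).
Proof.
move=> /saturate[g [vg lnk full]].
have [|h [vh lnk' low]] := lower_all vg.
  by move=> c pc lt_g; apply: full => //; move: lt_g; clear; lia.
exists h; split; last exact: rst_trans lnk lnk'.
case: vh => h0 hb hd hs; split=> // l c pl; case: eqP => [el|_]; last exact: hb.
by subst l; have := low c pl; clear; lia.
Qed.

End PushDown.

(** * Induction on the sum of the bounds, and connectivity *)

Lemma valid_linked (b : nat -> nat) (f g : nat -> nat -> nat) :
  (forall l, b l <= l) ->
  (forall l m, 0 < part a l -> 0 < part a m -> l <= m -> b l <= b m) ->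
  valid a b f -> valid a b g -> linked (tab a f) (tab a g).
Proof.
have [k] := ubnP (\sum_(l < n.+1) b l); elim: k b f g => // k IH b f g lt_k.
move=> b_id b_mono vf vg.
pose loose l := (0 < part a l) && ((rank l).+1 < b l).
have [exj|tight] := pselect (exists l, loose l); last first.
  (* With no loose label, each row is squeezed between [rank l] and [(rank l).+1]. *)
  suff -> : tab a f = tab a g by apply: rst_refl.
  have bound l : 0 < part a l -> b l <= (rank l).+1.
    move=> pos; rewrite leqNgt; apply/negP => lt_r; case: tight; exists l.
    by rewrite /loose pos.
  apply: (tab_ext vf vg) => l c pl; have := bound l (present_pos pl).
  have := rank_lt_valid vf pl; have := rank_lt_valid vg pl.
  by have := valid_flag vf pl; have := valid_flag vg pl; clear; lia.
have [j /andP[j_pos rank_j] minj] := ex_minnP exj.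
have below l : 0 < part a l -> l < j -> b l <= (rank l).+1.
  move=> pos lt_lj; rewrite leqNgt; apply/negP => lt_r.
  by have := minj l; rewrite /loose pos lt_r leqNgt lt_lj => /(_ isT).
have [f' [vf' lnkf]] := push_down b_id b_mono j_pos below rank_j vf.
have [g' [vg' lnkg]] := push_down b_id b_mono j_pos below rank_j vg.
apply: rst_trans lnkf _; apply: rst_trans (rst_sym _ _ _ _ lnkg).
apply: IH vf' vg'.
- have lt_j : j < n.+1 by have := part_bound j_pos; clear; lia.
  move: lt_k; rewrite (bigD1 (Ordinal lt_j)) //=.
  rewrite [X in X < k](bigD1 (Ordinal lt_j)) //= eqxx.
  rewrite [in X in _ -> X](eq_bigr (fun l : 'I_n.+1 => b l)) => [|l ne].
    by move: rank_j; clear; lia.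
  by rewrite ifN.
- by move=> l; case: eqP => [->|_]; [apply: leq_trans (b_id j); apply: leq_pred|].
- move=> l m pl pm le_lm; case: (l =P j) => [el|nl]; case: (m =P j) => [em|nm].
  + by [].
  + subst l; exact: leq_trans (leq_pred _) (b_mono _ _ pl pm le_lm).
  (* Monotonicity survives since [b l <= (rank l).+1 <= rank j], which is less than [(b j).-1]. *)
  + subst m; have lt_lj : l < j by rewrite ltn_neqAle le_lm andbT; apply/eqP.
    have := below l pl lt_lj; have := rank_lt pl lt_lj; move: rank_j; clear; lia.
  + exact: b_mono.
Qed.

End Connectivity.

Theorem theorem4p5 (n : nat) (a : n.-tuple nat) :
  connected_graph (LKT a)
    (fun T U => exists i : nat, 1 <= i < n /\ lock_raise a i T = Some U).
Proof.
(* Placing each label [l] in row [l] gives a tableau, so there is a vertex. *)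
have vid : valid a id (fun l _ => l).
  split=> // l c; first by move/present_bound => /andP[].
split; first by exists (tab a (fun l _ => l)); apply: LKT_tab.
move=> T U /tab_of_LKT[f vf ->] /tab_of_LKT[g vg ->].
have := valid_linked (leqnn) (fun l m _ _ le => le) vf vg.
by rewrite /linked size_tuple.
Qed.
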